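(* Any monotone small class of graphs admits an implicit representation.
   Context: All graphs are finite, undirected, without loops or multiple edges; $\log$ is the base-2 logarithm. A class of graphs is a set of graphs closed under isomorphism. A class is monotone if it is closed under taking subgraphs (i.e., under vertex and edge deletions). For a class $\mathcal{X}$, $\mathcal{X}_n$ denotes the set of graphs in $\mathcal{X}$ with vertex set $[n]=\{1,\dots,n\}$. A class $\mathcal{X}$ is small if there is a constant $c$ such that $|\mathcal{X}_n|\leq n!\,c^n$ for every $n\in\mathbb{N}$. For a function $b:\mathbb{N}\to\mathbb{N}$, a $b(n)$-bit adjacency labeling scheme for $\mathcal{X}$ is a pair (encoder, decoder) such that for any $n$-vertex graph $G\in\mathcal{X}_n$ the encoder assigns binary strings (labels) of length $b(n)$ to the vertices of $G$ so that the adjacency between any pair of vertices can be inferred by the decoder from their two labels only; the decoder depends on the class $\mathcal{X}$ but not on the graph $G$. The existence of a $b(n)$-bit labeling scheme is equivalent to the existence of a universal graph of size $2^{b(n)}$, i.e., a sequence $(U_n)_{n\in\mathbb{N}}$ of graphs such that $U_n$ has at most $2^{b(n)}$ vertices and every $n$-vertex graph in $\mathcal{X}$ is (isomorphic to) an induced subgraph of $U_n$. A class $\mathcal{X}$ admits an implicit representation if it has a $b(n)$-bit adjacency labeling scheme of information-theoretically optimal order, i.e., with $b(n)=O\left(\max\left\{1,\frac{\log|\mathcal{X}_n|}{n}\right\}\right)$ (over those $n$ for which $\mathcal{X}_n\neq\emptyset$). *)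

(* Defs.v *)
From HB Require Import structures.
From mathcomp Require Import all_boot all_order all_algebra.
From mathcomp Require Import boolp classical_sets reals topology normedtype.
From mathcomp Require Import landau exp.

Set Implicit Arguments.
Unset Strict Implicit.
Unset Printing Implicit Defensive.

Import Order.TTheory GRing.Theory Num.Theory.
Import numFieldNormedType.Exports.
Local Open Scope classical_set_scope.
Local Open Scope ring_scope.

Record sgraph (V : finType) := SGraph {
  edges : {set {set V}};
  edges_card2 : [forall e in edges, #|e| == 2] }.

HB.instance Definition _ (V : finType) := [isSub for @edges V].
HB.instance Definition _ (V : finType) := [Finite of sgraph V by <:].

(* Irreflexive: [set x; x] is a singleton, hence never an edge. *)
Definition adj (V : finType) (G : sgraph V) : rel V :=
  fun x y => [set x; y]%SET \in edges G.

Definition isomorphic (V W : finType) (G : sgraph V) (H : sgraph W) : Prop :=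
  exists2 f : V -> W, bijective f & forall x y, adj H (f x) (f y) = adj G x y.

Record graph_class := GraphClass {
  in_class :> forall V : finType, sgraph V -> Prop;
  in_class_iso : forall (V W : finType) (G : sgraph V) (H : sgraph W),
    isomorphic G H -> in_class G -> in_class H }.

Lemma induced_card2 (V : finType) (G : sgraph V) (A : {set V}) :
  [forall e in [set e : {set {x : V | x \in A}} | val @: e \in edges G]%SET,
    #|e| == 2].
Proof.
apply/forall_inP => e; rewrite inE => eG.
have /forall_inP/(_ _ eG) := edges_card2 G.
by rewrite card_imset //; exact: val_inj.
Qed.

Definition induced (V : finType) (G : sgraph V) (A : {set V}) :
  sgraph {x : V | x \in A} := SGraph (induced_card2 G A).

Definition monotone (X : graph_class) : Prop :=
  (forall (V : finType) (G H : sgraph V),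
     edges H \subset edges G -> X V G -> X V H) /\
  (forall (V : finType) (G : sgraph V) (A : {set V}),
     X V G -> X {x : V | x \in A} (induced G A)).

(* The vertex set {1, ..., n} is rendered as 'I_n = {0, ..., n - 1}. *)
Definition slice (X : graph_class) (n : nat) : {set sgraph 'I_n} :=
  [set G | `[< X 'I_n G >]]%SET.

Definition small (R : realType) (X : graph_class) : Prop :=
  exists c : R, forall n : nat, #|slice X n|%:R <= n`!%:R * c ^+ n.

(* The decoder sees the two labels only: neither the graph nor n is given to
   it. Distinct vertices may share a label; since the case x = y is included,
   adjacent vertices may not. *)
Definition labeling_scheme (X : graph_class) (b : nat -> nat) : Prop :=
  exists (enc : forall n : nat, sgraph 'I_n -> 'I_n -> (b n).-tuple bool)
         (dec : seq bool -> seq bool -> bool),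
  forall (n : nat) (G : sgraph 'I_n), G \in slice X n ->
  forall x y : 'I_n, dec (enc n G x) (enc n G y) = adj G x y.

Definition log2 (R : realType) (x : R) : R := ln x / ln 2.

Definition implicit_representation (R : realType) (X : graph_class) : Prop :=
  exists2 b : nat -> nat, labeling_scheme X b &
    (fun n => (b n)%:R : R^o)
      =O_ (within [set n | slice X n != finset.set0]%classic \oo)
    (fun n => Num.max 1 (log2 (#|slice X n|%:R : R) / n%:R) : R^o).

(* Main.v *)
Require Import Defs.
From mathcomp Require Import boolp classical_sets topology normedtype.
From mathcomp Require Import landau exp.
From mathcomp Require Import all_boot all_order all_algebra perm.
From mathcomp Require Import reals.
From mathcomp Require Import zify lra.

(** Why the theorem holds.  There are two regimes, according to whether the
    sizes of the matchings occurring in graphs of X are bounded.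

    Bounded matchings.  The ends of a maximal matching form a vertex cover
    ([matching_or_cover]), so all graphs of X have a vertex cover of bounded
    size k.  A label of 2k bits records which cover vertex the vertex is, if
    any, and which cover vertices it sees ([cover_labeling]).  A constant
    number of bits is always of the optimal order.

    Unbounded matchings.  By monotonicity X contains every graph on n vertices
    that consists of n/2 disjoint edges, hence X_n has at least (n/2)! elements
    ([card_matchings]) and log |X_n| / n is at least of order log n.  So labels
    of O(log n) bits are good enough.  They exist as soon as the edges of all
    graphs of X can be oriented with outdegree at most some constant D: a
    label lists the name of the vertex and those of its out-neighbours
    ([orientation_labeling]).

    The heart of the matter is that a monotone small class has bounded
    degeneracy ([small_orientation]).  If some graph of X had a subgraph of
    large minimum degree, a maximum cut of it would give disjoint vertex sets A
    and B with |B| <= |A| such that every a in A has at least d neighbours in B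
    ([half_cut]); fix d of them and call them D(a).  Choose a nonempty A' inside
    A that is minimal with |D(A')| <= |A'|.  Since cardinalities are
    integers, minimality yields |D(C)| > |C| for every nonempty proper subset C
    of A', and |D(A')| = |A'| = r.  Hall's theorem matches A' with D(A'),
    say a_i with b_i, and the strict inequality says that no nonempty proper
    set of indices is closed under the relation: b_j lies in D(a_i)
    ([tight_system]).  So, from any root, every index is reached by a tree of
    arcs i -> j of this kind ([spanning_parent]).

    Now count the labelled graphs on 2r vertices which are copies of a
    subgraph containing the matching edges a_i b_i and the edges a_i b_j for
    the tree arcs i -> j.  There are (2r)! labellings and at least 2^((d-2)r)
    such subgraphs.  Conversely, from the resulting labelled graph, the label
    of the root, and O(log d) further bits per vertex one recovers everything:
    degrees of the a_i are at most d, so a number below d suffices to tell a_i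
    which of its neighbours is its partner, and which is a given child
    ([code_inj]).  Observe that the degrees of the b_j, on which there is no
    bound, do not enter: one walks from b_i to a_i by looking for the vertex
    whose partner is b_i.  Therefore
    (2r)! 2^((d-2)r) <= |X_2r| 2r (d+2)^(2r) (d+1)^r  ([card_copies]),
    which contradicts |X_2r| <= (2r)! c^(2r) once d is large in terms of c. *)

Set Implicit Arguments.
Unset Strict Implicit.
Unset Printing Implicit Defensive.

Import Order.TTheory GRing.Theory Num.Theory.
Import numFieldNormedType.Exports.

(** * Graphs given by relations, and subgraphs in a monotone class *)

Lemma adj_sym (V : finType) (G : sgraph V) : symmetric (adj G).
Proof. by move=> x y; rewrite /adj setUC. Qed.

Lemma adj_irrefl (V : finType) (G : sgraph V) x : adj G x x = false.
Proof.
apply/negP => /(forall_inP (edges_card2 G)).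
by rewrite setUid cards1.
Qed.

Lemma edgesP (V : finType) (G : sgraph V) (e : {set V}) :
  e \in edges G -> exists x y, e = [set x; y] /\ adj G x y.
Proof.
move=> eG; have /cards2P[x [y [_ def_e]]] := forall_inP (edges_card2 G) _ eG.
by exists x, y; rewrite /adj -def_e.
Qed.

Lemma rel_edges_card2 (V : finType) (r : rel V) :
  [forall e in [set [set z.1; z.2] | z : V * V & (z.1 != z.2) && r z.1 z.2],
     #|e| == 2].
Proof.
by apply/forall_inP => e /imsetP[z]; rewrite inE => /andP[zz _] ->; rewrite cards2 zz.
Qed.

Definition graph_of (V : finType) (r : rel V) : sgraph V :=
  SGraph (rel_edges_card2 r).

Lemma adj_graph_of (V : finType) (r : rel V) x y :
  adj (graph_of r) x y = (x != y) && (r x y || r y x).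
Proof.
apply/imsetP/idP => [[[u v]] |].
  rewrite inE => /andP[/= uv ruv] E.
  have [xE yE] : x \in [set u; v] /\ y \in [set u; v] by rewrite -E set21 set22.
  have [uE vE] : u \in [set x; y] /\ v \in [set x; y] by rewrite E set21 set22.
  have xy : x != y.
    by apply: contra_neq uv => xy; move: uE vE; rewrite xy !inE !orbb => /eqP-> /eqP.
  rewrite xy; case/set2P: xE xy => ->; case/set2P: yE => -> //=;
    by rewrite ?eqxx ?ruv ?orbT.
case/andP=> xy /orP[rxy|ryx]; [exists (x, y) | exists (y, x)] => //=.
- by rewrite inE /= xy.
- by rewrite inE /= eq_sym xy.
- by rewrite setUC.
Qed.

(** All uses of monotonicity and of invariance under isomorphism go through this
    lemma: restrict [G] to the image of [f], pull it back along [f], and then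
    delete edges. *)
Lemma class_subgraph (X : graph_class) (V W : finType) (G : sgraph V)
    (H : sgraph W) (f : W -> V) :
  monotone X -> X V G -> injective f ->
  (forall x y, adj H x y -> adj G (f x) (f y)) -> X W H.
Proof.
move=> [Xsub Xind] XG f_inj HG.
pose A := f @: [set: W]; pose K := graph_of (fun x y => adj G (f x) (f y)).
have fA x : f x \in A by exact: imset_f.
have bij_g : bijective (fun x => exist (fun y => y \in A) (f x) (fA x)).
  apply: inj_card_bij; first by move=> x y [/f_inj].
  by rewrite card_sig card_imset // cardsT.
apply: (Xsub _ K).
  apply/subsetP => e /edgesP[x [y [-> xy]]].
  rewrite -/(adj K x y) adj_graph_of HG // andbT.
  by apply: contraTneq xy => ->; rewrite adj_irrefl.
have [h gK hK] := bij_g.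
apply: (in_class_iso _ (Xind _ _ A XG)); exists h.
  by exists (fun x => exist (fun y => y \in A) (f x) (fA x)).
move=> u v; rewrite -{2}[u]hK -{2}[v]hK; set x := h u; set y := h v.
rewrite adj_graph_of [adj G (f y) _]adj_sym orbb /adj /= inE imsetU1 imset_set1 /=.
rewrite -/(adj G (f x) (f y)).
by case: eqP => [->|//]; rewrite adj_irrefl.
Qed.

(** * Hall's theorem and spanning trees of strongly connected relations *)

Section Hall.
Variables T U : finType.
Implicit Types (D : T -> {set U}) (A : {set T}).

Definition nbhd D A := \bigcup_(a in A) D a.

Definition hall D := [forall A : {set T}, #|A| <= #|nbhd D A|].

Lemma nbhdS D A (B : {set T}) : A \subset B -> nbhd D A \subset nbhd D B.
Proof.
move=> AB; apply/bigcupsP => a aA.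
exact: bigcup_sup (subsetP AB _ aA).
Qed.

Definition remove D a x : T -> {set U} :=
  fun b => if b == a then D a :\ x else D b.

Lemma nbhd_remove D a x A : nbhd (remove D a x) (a |: A) = (D a :\ x) :|: nbhd D (A :\ a).
Proof.
rewrite /nbhd -(setD1K (setU11 a A)) big_setU1 ?setD11 //= /remove eqxx; congr (_ :|: _).
have -> : (a |: A) :\ a = A :\ a by apply/setP=> b; rewrite !inE; case: eqP.
by apply: eq_bigr => b; rewrite /remove !inE => /andP[/negPf->].
Qed.

Lemma nbhd_remove_out D a x A : a \notin A -> nbhd (remove D a x) A = nbhd D A.
Proof.
move=> aA; apply: eq_bigr => b bA; rewrite /remove; case: eqP => // E.
by rewrite -E bA in aA.
Qed.

(** Rado's proof of Hall's theorem.  Hall's condition survives the removal of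
    one of two given elements [x], [y] of [D a]: otherwise there are violators
    of the two weakened conditions, and submodularity of the size of the
    neighbourhood, applied to their union and intersection, contradicts
    Hall's condition for [D].  So one can shrink until all [D a] are
    singletons, and these are then distinct. *)
Lemma hall_matching D : hall D -> exists2 f : T -> U, injective f & forall a, f a \in D a.
Proof.
have [n] := ubnP (\sum_a #|D a|); elim: n D => // n IHn D Dn hallD.
have hD A : #|A| <= #|nbhd D A| by exact: (forallP hallD).
have [one|] := boolP [forall a, #|D a| == 1].
  have [f Df] : exists f : T -> U, forall a, D a = [set f a].
    have /all_sig[f Df] a : {x | D a = [set x]}.
      have /cards1P Da := forallP one a.
      by case: (pickP (mem (D a))) => [x xD|D0];
         [exists x; case: Da => y Ey; move: xD; rewrite Ey !inE => /eqP->
         | exfalso; case: Da => y Ey; have := D0 y; rewrite Ey !inE eqxx].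
    by exists f.
  exists f => [a b fab|a]; last by rewrite Df set11.
  apply/eqP; case: eqVneq => // ab; have := hD [set a; b].
  by rewrite /nbhd bigcup_setU !big_set1 !Df fab setUid cards2 cards1 ab.
rewrite negb_forall => /existsP[a Da].
have Da2 : 1 < #|D a|.
  by have := hD [set a]; rewrite cards1 /nbhd big_set1; case: #|D a| Da => [|[]].
have [x [y [xD yD xy]]] := card_gt1P Da2.
have smaller z : z \in D a -> hall (remove D a z) ->
    exists2 f : T -> U, injective f & forall a, f a \in D a.
  move=> zD hz; case: (IHn (remove D a z)) => // [|f f_inj fD].
    rewrite -ltnS; apply: leq_trans Dn; rewrite ltnS (bigD1 a) //= [in X in _ < X](bigD1 a) //=.
    rewrite /remove eqxx (cardsD1 z (D a)) zD add1n ltnS leq_add2l.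
    by apply: leq_sum => b /negPf ba; rewrite /remove ba.
  exists f => // b; have := fD b; rewrite /remove; case: eqP => // ->.
  by case/setD1P.
have [|nx] := boolP (hall (remove D a x)); first exact: smaller.
have [|ny] := boolP (hall (remove D a y)); first exact: smaller.
(* A violator must contain [a]; it is convenient to take [a] out of it. *)
have bad z : ~~ hall (remove D a z) -> exists2 A : {set T}, a \notin A &
    #|(D a :\ z) :|: nbhd D A| <= #|A|.
  rewrite negb_forall => /existsP[A]; rewrite -ltnNge => hA.
  have aA : a \in A.
    by apply: contraLR hA => aA; rewrite -leqNgt nbhd_remove_out.
  exists (A :\ a); first by rewrite setD11.
  rewrite -nbhd_remove (setUidPr _) ?sub1set //.
  by move: hA; rewrite (cardsD1 a A) aA add1n ltnS.
have [A aA hA] := bad x nx; have [B aB hB] := bad y ny; exfalso.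
have [hU hI] := (hD (a |: (A :|: B)), hD (A :&: B)).
rewrite cardsU1 !inE (negPf aA) (negPf aB) /= add1n in hU.
have sU : nbhd D (a |: (A :|: B)) \subset
    ((D a :\ x) :|: nbhd D A) :|: ((D a :\ y) :|: nbhd D B).
  rewrite /nbhd !bigcup_setU big_set1; apply/subsetP => z.
  rewrite !inE; case: (eqVneq z x) => [->|_] /=.
    by rewrite xD xy; case: (x \in \bigcup_(i in A) D i); rewrite ?orbT.
  by case/orP=> [->//|/orP[]->]; rewrite ?orbT.
have sI : nbhd D (A :&: B) \subset
    ((D a :\ x) :|: nbhd D A) :&: ((D a :\ y) :|: nbhd D B).
  by rewrite subsetI !subsetU ?nbhdS ?subsetIl ?subsetIr ?orbT.
have := cardsUI ((D a :\ x) :|: nbhd D A) ((D a :\ y) :|: nbhd D B).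
have := cardsUI A B.
have := subset_leq_card sU; have := subset_leq_card sI; lia.
Qed.

End Hall.

(** If no proper set containing the root [o] is closed under [N], a
    search from [o] reaches everything.  The spanning tree found by the search
    is recorded by the parent function [p]; that every index is reached from
    [o] through [p] is put as an induction principle, the form in which
    [code_inj] uses it. *)
Lemma spanning_parent (I : finType) (N : I -> {set I}) (o : I) :
  (forall i, i \in N i) ->
  (forall J : {set I}, o \in J -> (forall i, i \in J -> N i \subset J) -> J = setT) ->
  exists2 p : I -> I, (forall j, j \in N (p j)) &
    forall J : {set I}, o \in J -> (forall j, p j \in J -> j \in J) -> J = setT.
Proof.
move=> NI Nclosed.
pose reaches (p : I -> I) (S : {set I}) := forall J : {set I},
  o \in J -> (forall j, p j \in J -> j \in J) -> S \subset J.
(* Grow the reached set [S] one index at a time; [p] is the identity on the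
   indices still to be reached. *)
suff grow n : n <= #|I| -> exists p : I -> I, exists2 S : {set I}, n <= #|S| &
    [/\ o \in S, (forall j, j \in N (p j)), (forall j, j \notin S -> p j = j) &
        reaches p S].
  have [p [S Sn [_ pN _ rS]]] := grow _ (leqnn _).
  exists p => // J oJ pJ; apply/eqP; rewrite -subTset.
  have /eqP <- : S == setT by rewrite eqEcard subsetT cardsT.
  exact: rS.
elim: n => [|n IHn] nI.
  exists id, [set o] => //; split=> //; first by rewrite set11.
  by move=> J oJ _; rewrite sub1set.
have [p [S Sn [oS pN pid rS]]] := IHn (ltnW nI).
have [nS|Sle] := ltnP n #|S|; first by exists p, S.
have [/forall_inP cS|] := boolP [forall i in S, N i \subset S].
  by move: (Nclosed S oS cS) nI Sle => ->; rewrite cardsT => /leq_trans H /H; rewrite ltnn.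
rewrite negb_forall_in => /exists_inP[i iS /subsetPn[j jN jS]].
exists (fun k => if k == j then i else p k), (j |: S).
  by rewrite cardsU1 jS.
split.
- by rewrite inE oS orbT.
- by move=> k; case: eqP => [->|].
- by move=> k; rewrite !inE => /norP[/negPf-> /pid].
move=> J oJ cJ; have SJ : S \subset J.
  apply: rS => // k pk.
  case: (eqVneq k j) => [E|kj].
    by move: pk; rewrite E pid.
  by apply: cJ; rewrite (negPf kj).
by rewrite subUset SJ sub1set andbT; apply: cJ; rewrite eqxx (subsetP SJ).
Qed.

(** * Minimal violators of Hall's condition *)

(** Take [A0] of least size.  Deleting one of its points leaves a set [B] with
    [#|B| < #|nbhd D B|], and so [#|nbhd D A0|] cannot be below [#|A0|].  The
    hypothesis [1 < d] excludes that [A0] is a single point. *)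
Lemma minimal_tight (T U : finType) (D : T -> {set U}) (A : {set T}) (d : nat) :
  1 < d -> A != set0 -> (forall a, a \in A -> #|D a| = d) ->
  #|nbhd D A| <= #|A| ->
  exists A0 : {set T}, [/\ A0 \subset A, A0 != set0, #|nbhd D A0| = #|A0| &
    forall B : {set T}, B \proper A0 -> B != set0 -> #|B| < #|nbhd D B|].
Proof.
move=> d1 A0 Dd DA.
pose P := fun B : {set T} => [&& B \subset A, B != set0 & #|nbhd D B| <= #|B|].
have PA : P A by rewrite /P subxx A0.
case: (arg_minnP (fun B : {set T} => #|B|) PA) => B /and3P[BA B0 DB] minB.
have lt (C : {set T}) : C \proper B -> C != set0 -> #|C| < #|nbhd D C|.
  move=> CB C0; rewrite ltnNge; apply: contraTN (proper_card CB) => DC.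
  by rewrite -leqNgt minB // /P (subset_trans (proper_sub CB)) // C0.
exists B; split=> //; apply/eqP; rewrite eqn_leq DB /=.
have /set0Pn[x xB] := B0.
have [E|Bx0] := eqVneq (B :\ x) set0.
  have Bx : B = [set x] by rewrite -(setD1K xB) E setU0.
  by move: DB; rewrite Bx /nbhd big_set1 cards1 Dd ?(subsetP BA) // leqNgt d1.
have := lt _ (properD1 xB) Bx0; have := nbhdS D (subsetDl B [set x]).
by move/subset_leq_card; rewrite (cardsD1 x B) xB; lia.
Qed.

(** A minimal violator, with the points of its two sides indexed so that equal
    indices are matched.  The last conclusion is the strict Hall condition in
    terms of indices: a closed [J] has its neighbourhood inside the partners of
    [J], hence not larger than [J]. *)
Lemma tight_system (T U : finType) (D : T -> {set U}) (A : {set T}) (d : nat) :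
  1 < d -> A != set0 -> (forall a, a \in A -> #|D a| = d) ->
  #|nbhd D A| <= #|A| ->
  exists r, exists (a : 'I_r.+1 -> T) (b : 'I_r.+1 -> U),
  [/\ injective a /\ injective b, forall i, a i \in A,
      forall i, b i \in D (a i), forall i, #|[set j | b j \in D (a i)]| = d &
      forall J : {set 'I_r.+1}, J != set0 ->
        (forall i j, i \in J -> b j \in D (a i) -> j \in J) -> J = setT].
Proof.
move=> d1 A0 Dd DA; have [B [BA B0 DB ltB]] := minimal_tight d1 A0 Dd DA.
have [r Br] : exists r, #|B| = r.+1.
  by exists #|B|.-1; rewrite prednK // card_gt0.
pose a (i : 'I_r.+1) : T := enum_val (cast_ord (esym Br) i).
have a_inj : injective a by move=> i j /enum_val_inj /cast_ord_inj.
have aB i : a i \in B by exact: enum_valP.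
have a_sub (J : {set 'I_r.+1}) : a @: J \subset B.
  by apply/subsetP => _ /imsetP[i _ ->].
have aN (J : {set 'I_r.+1}) : nbhd (D \o a) J = nbhd D (a @: J).
  by rewrite /nbhd big_imset //; exact: in2W.
have [|b b_inj bD] := @hall_matching _ _ (D \o a).
  apply/forallP => J; rewrite aN -(card_imset _ a_inj).
  have [->|J0] := eqVneq J set0; first by rewrite imset0 cards0.
  have [JB|JB] := boolP (a @: J \proper B).
    by apply/ltnW/ltB => //; rewrite imset_eq0.
  move: JB; rewrite properE a_sub negbK => JB.
  by have /eqP -> : a @: J == B; rewrite ?DB // eqEsubset a_sub.
have bN : b @: setT = nbhd D B.
  apply/eqP; rewrite eqEcard card_imset // cardsT card_ord DB Br leqnn andbT.
  by apply/subsetP => _ /imsetP[i _ ->]; apply/bigcupP; exists (a i).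
have bsurj i u : u \in D (a i) -> exists j, u = b j.
  move=> uD; have : u \in b @: setT by rewrite bN; apply/bigcupP; exists (a i).
  by case/imsetP => j _ ->; exists j.
exists r, a, b; split=> //.
- by move=> i; rewrite (subsetP BA).
- move=> i; rewrite -(Dd (a i)) ?(subsetP BA) // -(card_imset _ b_inj).
  congr #|pred_of_set _|; apply/setP => u; apply/imsetP/idP => [[j]|uD].
    by rewrite inE => ? ->.
  by have [j E] := bsurj _ _ uD; exists j; rewrite // inE -E.
move=> J J0 cJ; apply/eqP; apply: contraT => JT.
have aJ : a @: J \proper B.
  rewrite properEcard a_sub card_imset // Br -[X in _ < X]card_ord -cardsT.
  by apply: proper_card; rewrite properT.
have := ltB _ aJ; rewrite imset_eq0 => /(_ J0).
rewrite ltnNge card_imset // -(card_imset _ b_inj) subset_leq_card //.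
apply/subsetP => u /bigcupP[_ /imsetP[i iJ ->]] uD.
by have [j E] := bsurj _ _ uD; rewrite E imset_f // (cJ i) // -E.
Qed.

(** * Counting labelled copies of a tight bipartite graph *)

Section Copies.
(* The 2r labels are ['I_(r + r)]; a labelling is a permutation [s], which puts
   the label [lft s i] on a_i and the label [rgt s j] on b_j.  The pairs (i, j)
   of [S] are the edges a_i b_j that are kept. *)
Variables (r : nat).
Notation I := 'I_r.
Notation L := 'I_(r + r).
Implicit Types (s : {perm L}) (S : {set I * I}) (i j : I) (F : sgraph L).

Definition lft s i : L := s (lshift r i).
Definition rgt s i : L := s (rshift r i).

Lemma lft_inj s : injective (lft s).
Proof. by move=> i j /perm_inj /lshift_inj. Qed.

Lemma rgt_inj s : injective (rgt s).
Proof. by move=> i j /perm_inj /rshift_inj. Qed.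

Lemma lft_rgt s i j : (lft s i == rgt s j) = false.
Proof. by rewrite (inj_eq perm_inj) eq_lrshift. Qed.

Lemma lft_rgtP s (x : L) : (exists i, x = lft s i) \/ (exists i, x = rgt s i).
Proof.
rewrite -(permKV s x); case: (splitP (s^-1 x)%g) => i E; [left|right]; exists i;
  by congr (s _); apply: val_inj.
Qed.

Definition copy s S : sgraph L :=
  graph_of (fun x y => [exists ij in S, (x == lft s ij.1) && (y == rgt s ij.2)]).

Lemma adj_copyl s S i y :
  adj (copy s S) (lft s i) y = [exists j, ((i, j) \in S) && (y == rgt s j)].
Proof.
rewrite adj_graph_of; apply/idP/existsP => [/andP[_ /orP[]]|[j /andP[ijS /eqP->]]].
- case/exists_inP => -[i' j] /= ijS /andP[/eqP/lft_inj -> yE].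
  by exists j; rewrite ijS.
- by case/exists_inP => -[i' j] /= _ /andP[_]; rewrite lft_rgt.
rewrite lft_rgt /=; apply/orP; left; apply/exists_inP; exists (i, j) => //=.
by rewrite !eqxx.
Qed.

Lemma adj_copy s S i j : adj (copy s S) (lft s i) (rgt s j) = ((i, j) \in S).
Proof.
rewrite adj_copyl; apply/existsP/idP => [[j' /andP[? /eqP/rgt_inj->]] //|ij].
by exists j; rewrite ij eqxx.
Qed.

Lemma class_copy (X : graph_class) (V : finType) (G : sgraph V) (a b : I -> V) s S :
  monotone X -> X V G -> injective a -> injective b -> (forall i j, a i != b j) ->
  (forall ij, ij \in S -> adj G (a ij.1) (b ij.2)) -> X L (copy s S).
Proof.
move=> monX XG a_inj b_inj ab SG.
pose f x := match split ((s^-1)%g x) with inl i => a i | inr j => b j end.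
have fl i : f (lft s i) = a i by rewrite /f permK (unsplitK (inl i)).
have fr i : f (rgt s i) = b i by rewrite /f permK (unsplitK (inr i)).
apply: (class_subgraph (f := f) monX XG).
  move=> x y; case: (lft_rgtP s x) (lft_rgtP s y) => [] [i ->] [] [j ->]; rewrite ?fl ?fr.
  - by move/a_inj->.
  - by move/eqP; rewrite (negPf (ab _ _)).
  - by move/eqP; rewrite eq_sym (negPf (ab _ _)).
  - by move/b_inj->.
have ad i y : adj (copy s S) (lft s i) y -> adj G (f (lft s i)) (f y).
  rewrite adj_copyl => /existsP[j /andP[/SG ijS /eqP->]].
  by rewrite fl fr.
move=> x y; case: (lft_rgtP s x) => [] [i ->]; first exact: ad.
case: (lft_rgtP s y) => [] [j ->].
  by rewrite adj_sym => /ad; rewrite adj_sym.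
rewrite adj_graph_of => /andP[_ /orP[]] /exists_inP[ij _ /andP[]];
  by rewrite eq_sym lft_rgt.
Qed.

Definition nbrs F x : seq L := enum [pred z | adj F x z].

(** Meaningful only when [x] has at most [d] neighbours, [y] being one of them;
    the type is ['I_d.+1] so that [inord] applies. *)
Definition nbr_index d F x y : 'I_d.+1 := inord (index y (nbrs F x)).

Lemma nbr_index_inj d F x y z : size (nbrs F x) <= d ->
  adj F x y -> adj F x z -> nbr_index d F x y = nbr_index d F x z -> y = z.
Proof.
move=> Fd xy xz /(congr1 val).
have [yF zF] : y \in nbrs F x /\ z \in nbrs F x by rewrite !mem_enum.
rewrite /= !inordK ?ltnS ?(leq_trans (index_size _ _)) //.
by move/(congr1 (nth y (nbrs F x))); rewrite !nth_index.
Qed.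

Lemma size_nbrs_copy s S i d : #|[set j | (i, j) \in S]| <= d ->
  size (nbrs (copy s S) (lft s i)) <= d.
Proof.
move=> Sd; apply: leq_trans Sd; rewrite -cardE -(card_imset _ (@rgt_inj s)).
apply: subset_leq_card; apply/subsetP => y; rewrite inE adj_copyl.
by case/existsP=> j /andP[ijS /eqP->]; rewrite imset_f // inE.
Qed.

(** The value [None] marks the labels of the vertices b_j, so that the code also
    tells the two sides apart. *)
Definition partner_code d s F : {ffun L -> option 'I_d.+1} :=
  [ffun x => match split ((s^-1)%g x) with
             | inl i => Some (nbr_index d F x (rgt s i)) | inr _ => None end].

Definition child_code d (p : I -> I) s F : {ffun I -> 'I_d.+1} :=
  [ffun j => nbr_index d F (lft s (p j)) (rgt s j)].

Lemma partner_code_lft d s F i :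
  partner_code d s F (lft s i) = Some (nbr_index d F (lft s i) (rgt s i)).
Proof. by rewrite ffunE permK (unsplitK (inl i)). Qed.

Lemma partner_code_rgt d s F i : partner_code d s F (rgt s i) = None.
Proof. by rewrite ffunE permK (unsplitK (inr i)). Qed.

(** Decoding.  If the label of b_j is known, a_j is found as the vertex whose
    coded partner is b_j; if the label of a_(p j) is known, then b_j is its
    neighbour with the number given by the child code.  Along the tree given by
    [p], the label of b_o thus determines all labels, and then the edges. *)
Lemma code_inj d (p : I -> I) (o : I) s1 S1 s2 S2 :
  (forall J : {set I}, o \in J -> (forall j, p j \in J -> j \in J) -> J = setT) ->
  (forall i, #|[set j | (i, j) \in S1]| <= d) ->
  (forall i, (i, i) \in S1 :&: S2) -> (forall j, (p j, j) \in S1 :&: S2) ->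
  copy s1 S1 = copy s2 S2 -> rgt s1 o = rgt s2 o ->
  partner_code d s1 (copy s1 S1) = partner_code d s2 (copy s2 S2) ->
  child_code d p s1 (copy s1 S1) = child_code d p s2 (copy s2 S2) ->
  s1 = s2 /\ S1 = S2.
Proof.
move=> pJ Sd diag tree E oE muE nuE.
have d1 i : (i, i) \in S1 by case/setIP: (diag i).
have d2 i : (i, i) \in S2 by case/setIP: (diag i).
have t1 i : (p i, i) \in S1 by case/setIP: (tree i).
have t2 i : (p i, i) \in S2 by case/setIP: (tree i).
have lftE j : rgt s1 j = rgt s2 j -> lft s1 j = lft s2 j.
  move=> rE; have := congr1 (fun f : {ffun _} => f (lft s1 j)) muE.
  rewrite /= partner_code_lft; case: (lft_rgtP s2 (lft s1 j)) => [] [i lE]; last first.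
    by rewrite {2}lE partner_code_rgt.
  rewrite [in RHS]lE partner_code_lft -lE E => -[].
  move/nbr_index_inj => H; rewrite lE; congr (lft s2 _).
  apply: (@rgt_inj s2); rewrite -rE; apply/esym/H.
  - by rewrite -E size_nbrs_copy.
  - by rewrite -E adj_copy.
  - by rewrite lE adj_copy.
have allE : [set j | rgt s1 j == rgt s2 j] = setT.
  apply: pJ => [|j]; rewrite !inE; first by rewrite oE.
  move/eqP/lftE => lE; have := congr1 (fun f : {ffun _} => f j) nuE.
  rewrite /= !ffunE -lE E => /nbr_index_inj H; apply/eqP/H.
  - by rewrite -E size_nbrs_copy.
  - by rewrite -E adj_copy.
  - by rewrite lE adj_copy.
have rE j : rgt s1 j = rgt s2 j by apply/eqP; have := in_setT j; rewrite -allE inE.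
have sE : s1 = s2.
  apply/permP => x; rewrite -(splitK x); case: (split x) => i /=; last exact: rE.
  exact/lftE/rE.
split=> //; apply/setP => -[i j]; rewrite -(adj_copy s1) E sE; exact: adj_copy.
Qed.

End Copies.

(** Each index has [d] pairs in [N], and at most two pairs per index belong to the
    matching or the tree; the remaining ones can be chosen freely.  The factors
    on the right count the codes: the labelled graph, the label of the root,
    the partner code and the child code. *)
Lemma card_copies (X : graph_class) (V : finType) (G : sgraph V) (r d : nat)
    (a b : 'I_r.+1 -> V) (N : 'I_r.+1 -> {set 'I_r.+1}) :
  monotone X -> X V G -> injective a -> injective b -> (forall i j, a i != b j) ->
  (forall i j, j \in N i -> adj G (a i) (b j)) ->
  (forall i, i \in N i) -> (forall i, #|N i| = d) ->
  (forall J : {set 'I_r.+1}, J != set0 ->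
     (forall i, i \in J -> N i \subset J) -> J = setT) ->
  (r.+1 + r.+1)`! * 2 ^ (r.+1 * d - 2 * r.+1) <=
  #|slice X (r.+1 + r.+1)| *
    ((r.+1 + r.+1) * d.+2 ^ (r.+1 + r.+1) * d.+1 ^ r.+1).
Proof.
move=> monX XG a_inj b_inj ab NG NI Nd NJ.
have [|p pN pJ] := @spanning_parent _ N ord0 NI.
  by move=> J J0; apply: NJ; apply/set0Pn; exists ord0.
pose E : {set 'I_r.+1 * 'I_r.+1} := [set ij | ij.2 \in N ij.1].
pose T := [set (i, i) | i in 'I_r.+1] :|: [set (p i, i) | i in 'I_r.+1].
have cardE : #|E| = (r.+1 * d)%N.
  rewrite -sum1_card.
  rewrite (eq_bigl (fun ij : 'I_r.+1 * 'I_r.+1 => true && (ij.2 \in N ij.1)));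
    last by move=> ij; rewrite inE.
  rewrite -(pair_big_dep xpredT (fun i j => j \in N i) (fun _ _ => 1)) /=.
  under eq_bigr do rewrite sum1_card Nd.
  by rewrite sum_nat_const card_ord.
have cardT : #|T| <= 2 * r.+1.
  rewrite mul2n -addnn (leq_trans (leq_card_setU _ _)) // leq_add //;
  by rewrite (leq_trans (leq_imset_card _ _)) // card_ord.
have cardQ : r.+1 * d - 2 * r.+1 <= #|E :\: T|.
  rewrite -cardE -(cardsID T E) leq_subLR leq_add2r.
  exact: leq_trans (subset_leq_card (subsetIr _ _)) cardT.
have TE : T \subset E.
  by apply/subsetP => _ /setUP[] /imsetP[i _ ->]; rewrite inE.
pose n := r.+1 + r.+1.
pose dom := setX [set: {perm 'I_n}] (powerset (E :\: T)).
pose code (z : {perm 'I_n} * {set 'I_r.+1 * 'I_r.+1}) :=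
  let F := copy z.1 (T :|: z.2) in
  (F, (rgt z.1 ord0, partner_code d z.1 F, child_code d p z.1 F)).
have code_in z : z \in dom -> code z \in setX (slice X n) setT.
  case: z => s Q /setXP[_]; rewrite powersetE => /= QE; rewrite !inE andbT.
  apply/asboolP; apply: (class_copy s monX XG a_inj b_inj ab) => -[i j] /=.
  have: T :|: Q \subset E by rewrite subUset TE (subset_trans QE) ?subsetDl.
  by move/subsetP => H /H; rewrite inE; apply: NG.
have code_injective : {in dom &, injective code}.
  move=> [s1 Q1] [s2 Q2] /setXP[_ H1] /setXP[_ H2].
  move: H1 H2; rewrite !powersetE !subsetD => /andP[Q1E Q1T] /andP[Q2E Q2T].
  move=> Ec; have FE := congr1 fst Ec; have [oE muE nuE] := congr1 snd Ec.
  have [|||] := code_inj pJ _ _ _ FE oE muE nuE.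
  - move=> i; rewrite -(Nd i); apply/subset_leq_card/subsetP => j.
    have: T :|: Q1 \subset E by rewrite subUset TE.
    by rewrite inE => /subsetP H /H; rewrite inE.
  - by move=> i; rewrite !inE imset_f.
  - by move=> i; rewrite !inE [_ \in [set (p _, _) | _ in _]]imset_f // orbT.
  move=> /= -> QE; congr pair.
  have dT (Q : {set 'I_r.+1 * 'I_r.+1}) : [disjoint Q & T] -> Q = (T :|: Q) :\: T.
    by move=> QT; rewrite setDUl setDv set0U; apply/esym/setDidPl.
  by rewrite (dT _ Q1T) (dT _ Q2T) QE.
have : #|dom| <= #|setX (slice X n)
    [set: 'I_n * {ffun 'I_n -> option 'I_d.+1} * {ffun 'I_r.+1 -> 'I_d.+1}]|.
  rewrite -(card_in_imset code_injective); apply: subset_leq_card.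
  by apply/subsetP => _ /imsetP[z zd ->]; exact: code_in.
rewrite !cardsX !cardsT !card_prod !card_ffun card_option !card_ord.
rewrite card_Sn card_powerset.
by apply: leq_trans; rewrite leq_mul2l leq_exp2l // cardQ orbT.
Qed.

(** * Monotone small classes have bounded degeneracy *)

(** The choice of [d]: as [d.+2] is the power [2 ^ t], everything is compared
    through exponents, where [2 ^ t] beats the linear function [5 * c + 24]. *)
Lemma copies_bound_absurd c t d r : t = c + 6 -> d = 2 ^ t - 2 ->
  2 ^ (r.+1 * d - 2 * r.+1) <=
  c ^ (r.+1 + r.+1) * ((r.+1 + r.+1) * d.+2 ^ (r.+1 + r.+1) * d.+1 ^ r.+1) -> False.
Proof.
move=> tE dE; have t_big : 5 * c + 24 < 2 ^ t.
  have := ltn_expl c (ltnSn 1); rewrite tE expnD; lia.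
have d2 : d.+2 = 2 ^ t by lia.
have [c2 r2] := (ltnW (ltn_expl c (ltnSn 1)), ltnW (ltn_expl (r.+1 + r.+1) (ltnSn 1))).
move=> H; have : 2 ^ (r.+1 * d - 2 * r.+1) <=
   2 ^ (c * (r.+1 + r.+1) + ((r.+1 + r.+1) + t * (r.+1 + r.+1) + t * r.+1)).
  apply: leq_trans H _; rewrite !expnD !expnM.
  rewrite leq_mul //; last rewrite !leq_mul // -?expnD ?d2 //.
  - by rewrite -expnD leq_exp2r // addSn.
  - by rewrite leq_exp2r // -d2.
rewrite leq_exp2l //; nia.
Qed.

Lemma subset_of_card_ge (T : finType) (S : {set T}) d :
  d <= #|S| -> exists S' : {set T}, S' \subset S /\ #|S'| = d.
Proof.
move=> dS; exists [set x in take d (enum S)]; split.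
  by apply/subsetP => x; rewrite inE => /mem_take; rewrite mem_enum.
by rewrite cardsE (card_uniqP _) ?take_uniq ?enum_uniq // size_takel // -cardE.
Qed.

(** The disjointness of [A] and [B] makes the tight system found inside them a
    bipartite subgraph of [G], so that its copies are counted by
    [card_copies]. *)
Lemma small_no_dense (X : graph_class) (c : nat) :
  monotone X -> (forall n, #|slice X n| <= n`! * c ^ n) ->
  exists d, forall (V : finType) (G : sgraph V) (A B : {set V}),
    X V G -> A != set0 -> [disjoint A & B] -> #|B| <= #|A| ->
    (forall a, a \in A -> d <= #|[set y in B | adj G a y]|) -> False.
Proof.
move=> monX smallX; pose d := 2 ^ (c + 6) - 2.
have d1 : 1 < d.
  by rewrite /d expnD; have := ltn_expl c (ltnSn 1); lia.
exists d => V G A B XG A0 AB BA degA.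
have [D DP] : exists D : V -> {set V}, forall a, a \in A ->
    D a \subset [set y in B | adj G a y] /\ #|D a| = d.
  suff /choice[D DP] a : exists Da : {set V}, a \in A ->
      Da \subset [set y in B | adj G a y] /\ #|Da| = d by exists D.
  have [aA|] := boolP (a \in A); last by exists set0.
  have [Da [Dsub Dd]] := subset_of_card_ge (degA a aA).
  by exists Da.
have DB : #|nbhd D A| <= #|A|.
  apply: leq_trans BA; apply/subset_leq_card/bigcupsP => a aA.
  by apply: subset_trans (DP a aA).1 _; apply/subsetP => y; rewrite inE => /andP[].
have [r [a [b [[a_inj b_inj] aA bD Dd closedJ]]]] :=
  tight_system d1 A0 (fun a aA => (DP a aA).2) DB.
have Dadj i j : b j \in D (a i) -> b j \in B /\ adj G (a i) (b j).
  by move/(subsetP (DP _ (aA i)).1); rewrite inE => /andP[].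
have ab i j : a i != b j.
  apply/eqP => E; have [bB _] := Dadj _ _ (bD j).
  by move: (disjointFr AB (aA i)); rewrite E bB.
have NG i j : j \in [set j | b j \in D (a i)] -> adj G (a i) (b j).
  by rewrite inE => /Dadj[].
have NI i : i \in [set j | b j \in D (a i)] by rewrite inE.
have NJ (J : {set 'I_r.+1}) : J != set0 ->
    (forall i, i \in J -> [set j | b j \in D (a i)] \subset J) -> J = setT.
  move=> J0 cJ; apply: closedJ => // i j iJ bj.
  by apply: (subsetP (cJ i iJ)); rewrite inE.
have H := card_copies monX XG a_inj b_inj ab NG NI Dd NJ.
apply: (@copies_bound_absurd c (c + 6) d r) => //.
rewrite -(leq_pmul2l (fact_gt0 (r.+1 + r.+1))).
by apply: leq_trans H _; rewrite [leqRHS]mulnA leq_mul2r smallX orbT.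
Qed.

Section Cut.
Variables (V : finType) (e : rel V).
Hypotheses (e_sym : symmetric e) (e_irr : irreflexive e).

Definition cut (P : {set V}) :=
  [set z : V * V | [&& z.1 \in P, z.2 \notin P & e z.1 z.2]].

Lemma card_cutC P : #|cut (~: P)| = #|cut P|.
Proof.
rewrite -(card_imset _ (can_inj (@swap_pairK V V))).
apply: eq_card => -[x y]; apply/imsetP/idP => [[[u v]]|].
  by rewrite !inE /= negbK => /and3P[uP vP uv] [-> ->]; rewrite uP vP e_sym uv.
by rewrite !inE /= => /and3P[xP yP xy]; exists (y, x); rewrite // !inE /= negbK xP yP e_sym.
Qed.

(** Moving [v] out of [P] uncuts its edges to the complement and cuts its edges
    to [P].  The set [K] consists of the pairs which are cut both before and
    after. *)
Lemma cut_remove (P : {set V}) v : v \in P ->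
  #|cut P| + #|[set y in P | e v y]| = #|cut (P :\ v)| + #|[set y in ~: P | e v y]|.
Proof.
move=> vP.
pose K := [set z : V * V | [&& z.1 \in P :\ v, z.2 \notin P & e z.1 z.2]].
have -> : #|cut P| = #|K| + #|[set y in ~: P | e v y]|.
  have i2 : injective (fun y : V => (v, y)) by move=> x y [].
  rewrite -(card_imset _ i2) -[LHS](cardsID K); congr (_ + _).
    by apply: eq_card => -[x y]; rewrite !inE /=; case: (x == v); case: (x \in P); case: (y \in P); case: (e x y).
  apply: eq_card => -[x y]; rewrite !inE /=; apply/idP/imsetP => [|[z]].
    case: (eqVneq x v) => [->|] /=;
      last by case: (x \in P); case: (y \in P); case: (e x y).
    by move=> /and3P[_ yP vy]; exists y; rewrite // !inE yP.
  by rewrite !inE => /andP[zP vz] [-> ->]; rewrite eqxx vP zP vz.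
rewrite addnAC; congr (_ + _).
have i1 : injective (fun x : V => (x, v)) by move=> x y [].
rewrite -(card_imset _ i1) -[RHS](cardsID K); congr (_ + _).
  apply: eq_card => -[x y]; rewrite !inE /=.
  by case: (eqVneq y v) => [->|]; rewrite ?vP ?andbF //= ?andbb;
     case: (x == v); case: (x \in P); case: (y \in P); case: (e x y).
apply: eq_card => -[x y]; rewrite !inE /=; apply/imsetP/idP => [[z]|].
  rewrite !inE => /andP[zP vz] [-> ->]; rewrite eqxx vP zP e_sym vz /= !andbT.
  rewrite andbF andTb; by apply: contraTneq vz => ->; rewrite e_irr.
case: (eqVneq y v) => [->|] /=;
  last by case: (x == v); case: (x \in P); case: (y \in P); case: (e x y).
case xP: (x \in P); case xv: (e x v); rewrite ?andbF //= => _.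
by exists x; rewrite // inE xP e_sym.
Qed.

(** A maximum cut: moving [v] to the other side would otherwise improve it. *)
Lemma half_cut : exists P : {set V}, forall v,
  #|[set y | e v y]| <= 2 * #|[set y | e v y & (y \in P) != (v \in P)]|.
Proof.
have maxP : exists P : {set V}, forall Q, #|cut Q| <= #|cut P|.
  have [P _ maxP] := @arg_maxnP _ set0 xpredT (fun P => #|cut P|) isT.
  by exists P => Q; exact: maxP.
case: maxP => P maxP; exists P => v.
have side (Q : {set V}) : v \in Q -> (forall Q', #|cut Q'| <= #|cut Q|) ->
    #|[set y | e v y]| <= 2 * #|[set y in ~: Q | e v y]|.
  move=> vQ maxQ; have := cut_remove vQ; have := maxQ (Q :\ v).
  have -> : #|[set y | e v y]| = #|[set y in Q | e v y]| + #|[set y in ~: Q | e v y]|.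
    rewrite -(cardsID Q [set y | e v y]); congr (_ + _); apply: eq_card => y; rewrite !inE //.
    by rewrite andbC.
  lia.
have [vP|vP] := boolP (v \in P).
  apply: leq_trans (side P vP maxP) _; rewrite leq_mul2l /=.
  by apply/subset_leq_card/subsetP => y; rewrite !inE => /andP[/negPf-> ->].
apply: leq_trans (side (~: P) _ _) _; first by rewrite inE.
  by move=> Q; rewrite card_cutC.
rewrite leq_mul2l /=.
by apply/subset_leq_card/subsetP => y; rewrite !inE negbK => /andP[-> ->].
Qed.

End Cut.

(** The out-neighbours of [x] are [out x]; an edge may be oriented both ways. *)
Definition orients (V : finType) (e : rel V) (D : nat) (out : V -> {set V}) :=
  forall x, [/\ #|out x| <= D, forall y, y \in out x -> e x y &
                forall y, e x y -> y \in out x \/ x \in out y].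

(** Remove vertices of degree at most [D] one after the other, orienting the
    edges that remain at each of them away from it. *)
Lemma degenerate_orientation (V : finType) (e : rel V) (D : nat) : symmetric e ->
  (forall U : {set V}, U != set0 ->
     exists2 v, v \in U & #|[set y in U | e v y]| <= D) ->
  exists out, orients e D out.
Proof.
move=> e_sym degen.
suff [out outP] : exists out : V -> {set V}, forall x,
    [/\ #|out x| <= D, forall y, y \in out x -> e x y &
        forall y, x \in [set: V] -> y \in [set: V] -> e x y ->
          y \in out x \/ x \in out y].
  exists out => x; have [? ? H] := outP x; split=> // y.
  exact: H.
have [n] := ubnP #|[set: V]|; elim: n [set: V] => // n IHn U Un.
have [->|U0] := eqVneq U set0.
  by exists (fun=> set0) => x; rewrite cards0; split=> // y; rewrite inE.
have [v vU vD] := degen U U0.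
have [|out outP] := IHn (U :\ v).
  by move: Un; rewrite (cardsD1 v U) vU.
exists (fun x => if x == v then [set y in U | e v y] else out x) => x.
have [outD outE outU] := outP x; split; first by case: eqP.
  by move=> y; case: eqP => [->|_]; [rewrite inE => /andP[]|exact: outE].
move=> y xU yU xy.
case: eqP => [xv|/eqP xv]; first by left; rewrite inE yU -xv.
case: eqP => [yv|/eqP yv]; first by right; rewrite inE xU -yv e_sym.
by apply: outU; rewrite // !inE ?xv ?yv.
Qed.

(** A subgraph of minimum degree more than [2 * d] has, across a maximum cut, at
    least [d] edges at each vertex; the larger side of the cut plays the role
    of [A] in [small_no_dense]. *)
Lemma small_orientation (X : graph_class) (c : nat) :
  monotone X -> (forall n, #|slice X n| <= n`! * c ^ n) ->
  exists D, forall (V : finType) (G : sgraph V), X V G ->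
    exists out, orients (adj G) D out.
Proof.
move=> monX smallX; have [d no_dense] := small_no_dense monX smallX.
exists (2 * d) => V G XG; apply: degenerate_orientation; first exact: adj_sym.
move=> U U0; apply: contrapT => no_v.
have big u : u \in U -> 2 * d < #|[set y in U | adj G u y]|.
  by move=> uU; rewrite ltnNge; apply/negP => uD; apply: no_v; exists u.
pose e x y := [&& x \in U, y \in U & adj G x y].
have [P halfP] : exists P : {set V}, forall v,
  #|[set y | e v y]| <= 2 * #|[set y | e v y & (y \in P) != (v \in P)]|.
  apply: half_cut => [x y|x]; rewrite /e ?adj_irrefl ?andbF //.
  by rewrite adj_sym; case: (x \in U); case: (y \in U).
have cross (Q : {set V}) : (forall x y, (y \in Q) != (x \in Q) = ((y \in P) != (x \in P))) ->
    forall u, u \in U :&: Q -> d <= #|[set y in U :\: Q | adj G u y]|.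
  move=> QP u /setIP[uU uQ]; have := halfP u; have := big u uU.
  have -> : [set y in U | adj G u y] = [set y | e u y].
    by apply/setP => y; rewrite !inE /e uU.
  have -> : [set y | e u y & (y \in P) != (u \in P)] = [set y in U :\: Q | adj G u y].
    apply/setP => y; rewrite !inE /e uU -QP uQ.
    by case: (y \in Q); case: (y \in U); case: (adj G u y).
  lia.
have disj (Q : {set V}) : [disjoint U :&: Q & U :\: Q].
  by rewrite -setI_eq0; apply/eqP/setP => y; rewrite !inE; case: (y \in Q); rewrite ?andbF.
(* The hypothesis [cross] is symmetric in [P] and its complement. *)
wlog PU : P halfP cross / #|U :\: P| <= #|U :&: P|.
  move=> H; case: (leqP #|U :\: P| #|U :&: P|) => [|/ltnW PU]; first exact: H.
  apply: (H (~: P)).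
  - move=> v; apply: leq_trans (halfP v) _; rewrite leq_mul2l /=; apply: subset_leq_card.
    by apply/subsetP => y; rewrite !inE; case: (y \in P); case: (v \in P).
  - by move=> Q QP; apply: cross => x y; rewrite QP !inE; case: (y \in P); case: (x \in P).
  - by rewrite setDE setCK -setDE.
apply: (no_dense V G (U :&: P) (U :\: P) XG) => //; last exact: cross.
apply: contra_neq U0 => UP; apply/eqP; rewrite -cards_eq0 -(cardsID P U) UP cards0.
by move: PU; rewrite UP cards0 leqn0.
Qed.

(** * Labeling schemes *)

Definition matching (V : finType) (G : sgraph V) (k : nat) (l r : 'I_k -> V) :=
  [/\ injective l, injective r, forall i j, l i != r j & forall i, adj G (l i) (r i)].

(** Extend a matching greedily: when this is impossible, its ends cover all
    edges. *)
Lemma matching_or_cover (V : finType) (G : sgraph V) k :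
  (exists l r, @matching V G k l r) \/
  (exists2 C : {set V}, #|C| <= 2 * k & forall x y, adj G x y -> (x \in C) || (y \in C)).
Proof.
suff [[s [ss us es]]|C] : (exists s : seq (V * V), [/\ size s = k,
    uniq (unzip1 s ++ unzip2 s) & all (fun z => adj G z.1 z.2) s]) \/
  (exists2 C : {set V}, #|C| <= 2 * k & forall x y, adj G x y -> (x \in C) || (y \in C)).
- left; move: us; rewrite cat_uniq => /and3P[u1 /hasPn dis u2].
  have ltk (i : 'I_k) : i < size s by rewrite ss.
  case: s => [|z0 s0] in ss u1 u2 dis es ltk *.
    have noI (i : 'I_k) : False by have := ltk i.
    exists (fun i => match noI i with end), (fun i => match noI i with end).
    by split=> i; case: (noI i).
  move: ss ltk u1 u2 dis es; set s := z0 :: s0 => ss ltk u1 u2 dis es.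
  have n1 (i : 'I_k) : nth z0.1 (unzip1 s) i = (nth z0 s i).1 by rewrite (nth_map z0).
  have n2 (i : 'I_k) : nth z0.2 (unzip2 s) i = (nth z0 s i).2 by rewrite (nth_map z0).
  exists (fun i => (nth z0 s i).1), (fun i => (nth z0 s i).2); split.
  + move=> i j; rewrite -!n1 => /eqP; rewrite nth_uniq ?size_map // => /eqP ?.
    exact: val_inj.
  + move=> i j; rewrite -!n2 => /eqP; rewrite nth_uniq ?size_map // => /eqP ?.
    exact: val_inj.
  + move=> i j; apply/eqP => E.
    have /dis : (nth z0 s j).2 \in unzip2 s by rewrite map_f // mem_nth.
    by move/negP; apply; rewrite -E; apply: (map_f fst); rewrite mem_nth.
  + by move=> i; apply: (allP es); rewrite mem_nth.
- by right.
elim: k => [|k [[s [ss us es]]|[C Ck CP]]]; first by left; exists nil.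
  pose S := [set x in unzip1 s ++ unzip2 s].
  have Sk : #|S| <= 2 * k.
    rewrite cardsE (leq_trans (card_size _)) // size_cat !size_map ss; lia.
  have [covered|] := boolP [forall x, forall y, adj G x y ==> (x \in S) || (y \in S)].
    right; exists S; first by lia.
    by move=> x y xy; have /forallP/(_ y)/implyP := forallP covered x; apply.
  rewrite negb_forall => /existsP[x]; rewrite negb_forall => /existsP[y].
  rewrite negb_imply negb_or !inE => /and3P[xy xS yS].
  left; exists ((x, y) :: s); split; rewrite /= ?ss ?xy //.
  have xney : x != y by apply: contraTneq xy => ->; rewrite adj_irrefl.
  rewrite !mem_cat !negb_or in xS yS; case/andP: xS => x1 x2; case/andP: yS => y1 y2.
  rewrite !mem_cat !inE (negPf x1) (negPf x2) (negPf xney) /=.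
  rewrite (perm_uniq (_ : perm_eq _ (y :: unzip1 s ++ unzip2 s))) /= ?us ?andbT ?mem_cat ?negb_or ?y1 ?y2 //.
  exact: permEl (perm_catCA (unzip1 s) [:: y] (unzip2 s)).
by right; exists C; [lia|].
Qed.

(** By choice, encoders may be given graph by graph; the decoder is common to
    all graphs of all sizes. *)
Lemma labeling_by_graph (X : graph_class) (b : nat -> nat) (dec : seq bool -> seq bool -> bool) :
  (forall n (G : sgraph 'I_n), X 'I_n G ->
    exists enc : 'I_n -> (b n).-tuple bool, forall x y, dec (enc x) (enc y) = adj G x y) ->
  labeling_scheme X b.
Proof.
move=> H.
have encodable (n : nat) : exists enc : sgraph 'I_n -> 'I_n -> (b n).-tuple bool,
    forall G, X 'I_n G -> forall x y, dec (enc G x) (enc G y) = adj G x y.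
  suff /choice[enc encP] : forall G : sgraph 'I_n, exists enc : 'I_n -> (b n).-tuple bool,
    X 'I_n G -> forall x y, dec (enc x) (enc y) = adj G x y by exists enc.
  move=> G; have [/H[enc encP]|nX] := pselect (X 'I_n G); first by exists enc.
  by exists (fun=> [tuple of nseq (b n) false]).
exists (fun n => sval (cid (encodable n))), dec => n G.
by rewrite inE => /asboolP; exact: (svalP (cid (encodable n))).
Qed.

(** The label of [x] has two blocks of [k] bits: bit i of the first says whether
    [x] is the i-th vertex of the cover, bit i of the second whether [x] is
    adjacent to it. *)
Lemma cover_labeling (X : graph_class) k :
  (forall n (G : sgraph 'I_n), X 'I_n G -> exists2 C : {set 'I_n}, #|C| <= k &
     forall x y, adj G x y -> (x \in C) || (y \in C)) ->
  labeling_scheme X (fun=> k + k).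
Proof.
move=> cover.
pose dec (s t : seq bool) := [exists i : 'I_k,
  nth false s i && nth false t (k + i) || nth false t i && nth false s (k + i)].
apply: (@labeling_by_graph X (fun=> k + k) dec) => n G /cover[C Ck CP].
pose c i := nth None (map Some (enum C)) i.
pose f (x : 'I_n) i := if i < k then c i == Some x
   else if c (i - k) is Some z then adj G x z else false.
exists (fun x => [tuple f x i | i < k + k]) => x y.
have nthf x' (i : nat) : i < k + k -> nth false [tuple f x' j | j < k + k] i = f x' i.
  by move=> ik; rewrite -[i]/(val (Ordinal ik)) -tnth_nth tnth_mktuple.
have nthl x' (i : 'I_k) : nth false [tuple f x' j | j < k + k] i = (c i == Some x').
  by rewrite nthf ?ltn_addr // /f ltn_ord.
have nthr x' (i : 'I_k) : nth false [tuple f x' j | j < k + k] (k + i) =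
    if c i is Some z then adj G x' z else false.
  by rewrite nthf ?ltn_add2l // /f ltnNge leq_addr /= addKn.
have cP z : z \in C -> exists i : 'I_k, c i = Some z.
  move=> zC; have zi : index z (enum C) < #|C| by rewrite cardE index_mem mem_enum.
  exists (Ordinal (leq_trans zi Ck)).
  by rewrite /c /= (nth_map z) ?nth_index ?mem_enum // -cardE.
apply/existsP/idP => [[i]|xy].
  rewrite !nthl !nthr => /orP[] /andP[/eqP->] //.
  by rewrite adj_sym.
case/orP: (CP x y xy) => /cP[i ci]; exists i; rewrite !nthl !nthr ci eqxx /= ?xy ?orbT //.
by rewrite adj_sym xy.
Qed.

Definition bits (w x : nat) : seq bool := mkseq (fun i => odd (x %/ 2 ^ i)) w.

Lemma bits_inj w x y : x < 2 ^ w -> y < 2 ^ w -> bits w x = bits w y -> x = y.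
Proof.
elim: w x y => [|w IHw] x y; first by rewrite expn0 !ltnS !leqn0 => /eqP-> /eqP->.
rewrite expnS => xw yw; rewrite /bits /mkseq -[w.+1]add1n iotaD map_cat /= expn0 !divn1.
case=> oxy bxy; rewrite -(odd_double_half x) -(odd_double_half y) oxy; congr (_ + _.*2).
apply: IHw; [lia|lia|].
have shift z : [seq odd (z %/ 2 ^ i) | i <- iota 1 w] = bits w z./2.
  rewrite /bits /mkseq -[1]addn0 iotaDl -map_comp; apply: eq_map => i /=.
  by rewrite add1n expnS divnMA divn2.
by rewrite -!shift.
Qed.

(** A vertex name followed by exactly [D] words for the out-neighbours [s];
    missing ones are filled up with [x] itself, which is harmless since
    [adj_dec] only accepts distinct names. *)
Definition label w D x (s : seq nat) : seq bool :=
  flatten (map (bits w) (x :: take D (s ++ nseq D x))).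

(** The word length is not known to the decoder, but it is the length of the
    label divided by [D.+1]. *)
Definition adj_dec D (s t : seq bool) : bool :=
  let words u := reshape (nseq D.+1 (size u %/ D.+1)) u in
  let hd u := head [::] (words u) in
  (hd s != hd t) && ((hd t \in behead (words s)) || (hd s \in behead (words t))).

Lemma size_pad D x (s : seq nat) : size (x :: take D (s ++ nseq D x)) = D.+1.
Proof. by rewrite /= size_takel // size_cat size_nseq leq_addl. Qed.

Lemma shape_label w D x s :
  shape (map (bits w) (x :: take D (s ++ nseq D x))) = nseq D.+1 w.
Proof.
rewrite -(size_pad D x s) /shape -map_comp.
by elim: (x :: _) => //= a l ->; rewrite size_mkseq.
Qed.

Lemma size_label w D x s : size (label w D x s) = D.+1 * w.
Proof. by rewrite size_flatten shape_label sumn_nseq mulnC. Qed.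

Lemma adj_dec_label w D x s y t : (forall z, z \in x :: y :: s ++ t -> z < 2 ^ w) ->
  size s <= D -> size t <= D ->
  adj_dec D (label w D x s) (label w D y t) = (x != y) && ((y \in s) || (x \in t)).
Proof.
move=> small sD tD; rewrite /adj_dec !size_label mulKn //.
have wordsE u l : reshape (nseq D.+1 w) (label w D u l) =
    map (bits w) (u :: take D (l ++ nseq D u)).
  by rewrite -(shape_label w D u l) flattenK.
rewrite !wordsE [head _ _]/= [head _ _]/= [behead _]/= [behead _]/=.
have inj : {in x :: y :: s ++ t &, injective (bits w)}.
  by move=> u v /small uw /small vw; apply: bits_inj.
have xin : x \in x :: y :: s ++ t by rewrite inE eqxx.
have yin : y \in x :: y :: s ++ t by rewrite !inE eqxx orbT.
rewrite (inj_in_eq inj) //; case: (eqVneq x y) => //= xy.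
have pad z (l : seq nat) u : size l <= D -> {subset l <= x :: y :: s ++ t} ->
  z \in x :: y :: s ++ t -> u \in x :: y :: s ++ t -> z != u ->
  (bits w z \in [seq bits w i | i <- take D (l ++ nseq D u)]) = (z \in l).
  move=> lD lin zin uin zu.
  have tE : take D (l ++ nseq D u) = l ++ take (D - size l) (nseq D u).
    by rewrite take_cat ltnNge lD.
  rewrite tE map_cat mem_cat; apply/orP/idP => [[]|zl]; last by left; rewrite map_f.
    by case/mapP => v vl /inj -> //; exact: lin.
  case/mapP => v /mem_take /nseqP[-> _] /(inj _ _ zin uin) E.
  by rewrite E eqxx in zu.
have sin : {subset s <= x :: y :: s ++ t} by move=> z zs; rewrite !inE mem_cat zs !orbT.
have tin : {subset t <= x :: y :: s ++ t} by move=> z zs; rewrite !inE mem_cat zs !orbT.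
by rewrite !pad // eq_sym.
Qed.

Lemma orientation_labeling (X : graph_class) D (w : nat -> nat) :
  (forall n, n <= 2 ^ w n) ->
  (forall n (G : sgraph 'I_n), X 'I_n G ->
    exists out, orients (adj G) D out) ->
  labeling_scheme X (fun n => D.+1 * w n).
Proof.
move=> nw orient; apply: (@labeling_by_graph _ _ (adj_dec D)) => n G /orient[out outP].
pose l (x : 'I_n) := label (w n) D x (map val (enum (out x))).
have sl x : size (l x) == D.+1 * w n by rewrite size_label.
exists (fun x => Tuple (sl x)) => x y; rewrite /= adj_dec_label.
- rewrite !mem_map ?mem_enum; try exact: val_inj.
  rewrite (inj_eq val_inj).
  have [[_ outx inx] [_ outy _]] := (outP x, outP y).
  apply/andP/idP => [[_ /orP[/outx|/outy]] //|xy]; first by rewrite adj_sym.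
  split; first by apply: contraTneq xy => ->; rewrite adj_irrefl.
  by apply/orP; exact: inx.
- have val_lt (z : 'I_n) : z < 2 ^ w n by exact: leq_trans (ltn_ord z) (nw n).
  by move=> z; rewrite !inE mem_cat => /or3P[/eqP->|/eqP->|/orP[]/mapP[u _ ->]]; exact: val_lt.
- by rewrite size_map -cardE; case: (outP x).
- by rewrite size_map -cardE; case: (outP y).
Qed.

(** * Growth of the class and conclusion *)

(** Join i to m + s(i) for i below m, for all permutations [s] of m points.  The
    [q] extra vertices are isolated and serve to reach odd orders; they are
    embedded as further left ends of the large matching. *)
Lemma card_matchings (X : graph_class) m q : monotone X ->
  (exists (V : finType) (G : sgraph V), X V G /\ exists l r, @matching V G (m + q) l r) ->
  m`! <= #|slice X (m + m + q)|.
Proof.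
move=> monX [V [G [XG [l [r [l_inj r_inj lr lrE]]]]]].
pose L i : 'I_(m + m + q) := lshift q (lshift m i).
pose R i : 'I_(m + m + q) := lshift q (rshift m i).
pose F (s : 'S_m) := graph_of (fun x y => [exists i, (x == L i) && (y == R (s i))]).
have LR i j : (L i == R j) = false by rewrite (inj_eq (@lshift_inj _ _)) eq_lrshift.
have L_inj : injective L by move=> i j /lshift_inj /lshift_inj.
have R_inj : injective R by move=> i j /lshift_inj /rshift_inj.
have adjF s i j : adj (F s) (L i) (R j) = (j == s i).
  rewrite adj_graph_of LR /=; apply/orP/idP => [[]/existsP[k]|/eqP->].
  - by rewrite (inj_eq L_inj) (inj_eq R_inj) => /andP[/eqP->].
  - by rewrite LR andbF.
  - by left; apply/existsP; exists i; rewrite !eqxx.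
have F_inj : injective F.
  move=> s t E; apply/permP => i; apply/eqP.
  by rewrite -[_ == _]adjF -E adjF.
rewrite -card_Sn -cardsT -(card_imset _ F_inj); apply: subset_leq_card.
apply/subsetP => _ /imsetP[s _ ->]; rewrite inE; apply/asboolP.
pose f x := match split x with
  | inl y => match split y with
      | inl i => l (lshift q i) | inr i => r (lshift q ((s^-1)%g i)) end
  | inr z => l (rshift m z) end.
have fL i : f (L i) = l (lshift q i).
  by rewrite /f (unsplitK (inl (lshift m i))) (unsplitK (inl i)).
have fR i : f (R i) = r (lshift q ((s^-1)%g i)).
  by rewrite /f (unsplitK (inl (rshift m i))) (unsplitK (inr i)).
have fZ z : f (rshift (m + m) z) = l (rshift m z) by rewrite /f (unsplitK (inr z)).
have cases x : [\/ exists i, x = L i, exists i, x = R i | exists z, x = rshift (m + m) z].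
  rewrite -(splitK x); case: (split x) => [y|z] /=; last by constructor 3; exists z.
  by rewrite -(splitK y); case: (split y) => i /=; [constructor 1|constructor 2]; exists i.
have rl i j : (r i == l j) = false by rewrite eq_sym (negPf (lr _ _)).
apply: (class_subgraph (f := f) monX XG).
  move=> x y; case: (cases x) (cases y) => [] [i ->] [] [j ->]; rewrite ?fL ?fR ?fZ.
  - by move=> /l_inj /lshift_inj ->.
  - by move/eqP; rewrite (negPf (lr _ _)).
  - by move/l_inj/eqP; rewrite eq_lrshift.
  - by move/eqP; rewrite rl.
  - by move=> /r_inj /lshift_inj /perm_inj ->.
  - by move/eqP; rewrite rl.
  - by move/l_inj/eqP; rewrite eq_rlshift.
  - by move/eqP; rewrite (negPf (lr _ _)).
  - by move=> /l_inj /rshift_inj ->.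
move=> x y; rewrite adj_graph_of => /andP[_ /orP[]] /existsP[i /andP[/eqP-> /eqP->]].
  by rewrite fL fR permK lrE.
by rewrite fL fR permK adj_sym lrE.
Qed.

Lemma implicit_representation_of_bound (R : realType) (X : graph_class)
    (b : nat -> nat) (C : R) :
  labeling_scheme X b ->
  (forall n, 4 <= n ->
     ((b n)%:R <= C * Num.max 1 (log2 (#|slice X n|%:R : R) / n%:R))%R) ->
  implicit_representation R X.
Proof.
move=> lab bC; exists b => //; apply/eqO_exP; exists (Num.max 1%R C).
  by rewrite lt_max ltr01.
apply: cvg_within; exists 4 => // n /= n4.
rewrite normr_nat ger0_norm; last by rewrite le_max ler01.
by apply: le_trans (bC n n4) _; rewrite ler_wpM2r ?le_max ?ler01 ?lexx ?orbT.
Qed.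

Lemma expn_le_fact h k : h ^ k <= (h + k)`!.
Proof.
elim: k => [|k IHk]; first by rewrite expn0 fact_gt0.
by rewrite addnS factS expnS leq_mul // -addnS leq_addr.
Qed.

(** With [h = n %/ 4], the larger half of the factors of [(2 * h)`!] contributes
    at least [h ^ h], and [2 ^ (up_log 2 n - 4) <= h]; the loss of 4 in the
    exponent absorbs the rounding in [up_log] and in [h]. *)
Lemma exp2_le_fact n : 4 <= n -> 2 ^ ((up_log 2 n - 4) * (n %/ 4)) <= (n./2)`!.
Proof.
move=> n4; pose h := n %/ 4.
have h0 : 0 < h by rewrite divn_gt0.
have wh : 2 ^ (up_log 2 n - 4) <= h.
  have /andP[w1 w2] := @up_log_bounds 2 n isT (leq_trans (isT : 1 < 4) n4).
  have [w4|w4] := leqP (up_log 2 n) 4.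
    by have -> : up_log 2 n - 4 = 0 by lia.
  have wE : (up_log 2 n).-1 = (up_log 2 n - 4) + 3 by lia.
  move: w1; rewrite wE expnD => w1.
  have : n < 8 * h by rewrite /h; lia.
  lia.
rewrite expnM; apply: leq_trans (_ : h ^ h <= _); first by rewrite leq_exp2r.
apply: leq_trans (expn_le_fact h h) _; apply: leq_fact; rewrite /h; lia.
Qed.

Lemma small_nat (R : realType) (X : graph_class) :
  small R X -> exists c : nat, forall n, #|slice X n| <= n`! * c ^ n.
Proof.
case=> c cX; exists (Num.bound `|c|) => n.
rewrite -(ler_nat R) natrM natrX; apply: (le_trans (cX n)).
rewrite ler_wpM2l ?ler0n // (le_trans (ler_norm _)) // normrX.
by rewrite lerXn2r ?nnegrE ?normr_ge0 ?ler0n // ltW // archi_boundP.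
Qed.

(** With w = [up_log 2 n], [exp2_le_fact] gives that (w - 4) times a quarter of n
    is at most log |X_n|; the rounded quarter is at least n / 8, hence
    w <= 8 M + 4 <= 12 M, where M >= 1 is the right-hand maximum. *)
Lemma up_log_le_growth (R : realType) (X : graph_class) n :
  (4 <= n)%N -> (n./2`! <= #|slice X n|)%N ->
  ((up_log 2 n)%:R <= 12 * Num.max 1 (log2 (#|slice X n|%:R : R) / n%:R))%R.
Proof.
move=> n4 /(leq_trans (exp2_le_fact n4)).
set w := up_log 2 n; set s := #|_|; set M := Num.max _ _ => ws.
have M1 : (1 <= M)%R by rewrite le_max lexx.
have [w4|w4] := leqP w 4.
  by apply: le_trans (_ : 4%:R <= _)%R; [rewrite ler_nat | lra].
have ln2 : (0 < ln 2 :> R)%R by rewrite ln_gt0 // ltr1n.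
have n0 : (0 < n%:R :> R)%R by rewrite ltr0n; lia.
have s0 : (0 < s)%N by apply: leq_trans ws; rewrite expn_gt0.
have L : (((w - 4) * (n %/ 4))%:R <= log2 (s%:R : R))%R.
  rewrite /log2 ler_pdivlMr // mulr_natl -lnXn ?ltr0n // ler_ln ?posrE ?exprn_gt0 ?ltr0n //.
  by rewrite -natrX ler_nat.
have LM : (log2 (s%:R : R) <= M * n%:R)%R.
  by rewrite -ler_pdivrMr // le_max lexx orbT.
have n8 : (n%:R <= 8%:R * (n %/ 4)%:R :> R)%R by rewrite -natrM ler_nat; lia.
have h0 : (0 < (n %/ 4)%:R :> R)%R by rewrite ltr0n divn_gt0.
have : ((w - 4)%:R * (n %/ 4)%:R <= (8 * M) * (n %/ 4)%:R :> R)%R.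
  rewrite -natrM; apply: le_trans L _; apply: le_trans LM _.
  by rewrite [(8 * M)%R]mulrC -mulrA ler_wpM2l // (le_trans ler01 M1).
rewrite ler_pM2r // natrB ?(ltnW w4) //; lra.
Qed.

Theorem theorem1p2 (R : realType) (X : graph_class) :
  monotone X -> small R X -> implicit_representation R X.
Proof.
move=> monX /small_nat[c smallX].
pose has_matching k := exists (V : finType) (G : sgraph V),
  X V G /\ exists l r, @matching V G k l r.
have [all_match|/existsNP[k no_match]] := pselect (forall k, has_matching k).
  have [D orient] := small_orientation monX smallX.
  have lab : labeling_scheme X (fun n => D.+1 * up_log 2 n)%N.
    apply: orientation_labeling => [n|n G]; [exact: up_logP | exact: orient].
  apply: (implicit_representation_of_bound (C := D.+1%:R * 12) lab) => n n4.
  rewrite natrM -mulrA ler_wpM2l ?ler0n //; apply: up_log_le_growth => //.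
  have := card_matchings monX (all_match (n./2 + odd n)).
  by rewrite addnn addnC odd_double_half.
have lab : labeling_scheme X (fun=> 2 * k + 2 * k)%N.
  apply: cover_labeling => n G XG.
  have [match_k|//] := matching_or_cover G k.
  by case: no_match; exists 'I_n, G.
apply: (implicit_representation_of_bound (C := (2 * k + 2 * k)%:R) lab) => n _.
by rewrite ler_peMr ?ler0n // le_max lexx.
Qed.
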